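(* Let $H$ be a group, let $A,B\le H$ be subgroups, and let $\varphi\colon A\to B$ be an isomorphism. Let $G=\langle H,t\mid t^{-1}ut=\varphi(u),\ u\in A\rangle$ be the corresponding HNN extension of $H$ with associated subgroups $A,B$, and suppose that $G$ is finitely generated. If $AB\cup BA\neq H$, then the conjugacy growth function of $G$ is exponential.
   Context: For subsets $A,B$ of a group, $AB=\{ab: a\in A,\ b\in B\}$. Let $G=\langle X\rangle$ be a group generated by a finite set $X$. For every $n$ let $g_c(n)$ be the number of conjugacy classes of $G$ intersecting the ball of radius $n$ in $G$ (with respect to the word metric given by $X$). The function $g_c$ is called the conjugacy growth function of $G$. It is exponential if there is a constant $\lambda>1$ such that $g_c(n)\ge\lambda^n$ for all sufficiently large $n$ (an exponential upper bound is automatic, and the property does not depend on the choice of finite generating set). *)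

(* Defs.v *)
From HB Require Import structures.
From mathcomp Require Import all_boot all_order all_algebra.
From mathcomp Require Import finmap generic_quotient.
From mathcomp Require Import all_classical reals.

Set Implicit Arguments.
Unset Strict Implicit.
Unset Printing Implicit Defensive.

Local Open Scope classical_set_scope.
Local Open Scope quotient_scope.
Local Open Scope group_scope.

(* Letters: [inl h] is an element of the base group, [inr false] is the stable
   letter t and [inr true] its inverse. *)
Definition hnn_word (H : groupType) := seq (H + bool).

(* The congruence on words defining < H, t | t^-1 u t = phi u, u \in A >: the
   multiplication table of H, t t^-1 = t^-1 t = 1, and the HNN relations.
   Only the values of phi on A matter. *)
Inductive hnn_eq (H : groupType) (A : {pred H}) (phi : H -> H) :
    hnn_word H -> hnn_word H -> Prop :=
  | hnn_eq_refl w : hnn_eq A phi w w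
  | hnn_eq_sym v w : hnn_eq A phi v w -> hnn_eq A phi w v
  | hnn_eq_trans u v w :
      hnn_eq A phi u v -> hnn_eq A phi v w -> hnn_eq A phi u w
  | hnn_eq_cat v v' w w' :
      hnn_eq A phi v v' -> hnn_eq A phi w w' ->
      hnn_eq A phi (v ++ w) (v' ++ w')
  | hnn_eq_one : hnn_eq A phi [:: inl 1] [::]
  | hnn_eq_mul h k : hnn_eq A phi [:: inl h; inl k] [:: inl (h * k)]
  | hnn_eq_cancel b : hnn_eq A phi [:: inr b; inr (~~ b)] [::]
  | hnn_eq_conj u : u \in A ->
      hnn_eq A phi [:: inr true; inl u; inr false] [:: inl (phi u)].

Section HNN.
Variables (H : groupType) (A : {pred H}) (phi : H -> H).

Definition hnn_eqb : rel (hnn_word H) := fun v w => `[< hnn_eq A phi v w >].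

Lemma hnn_eqb_refl : reflexive hnn_eqb.
Proof. by move=> w; apply/asboolP; exact: hnn_eq_refl. Qed.

Lemma hnn_eqb_sym : symmetric hnn_eqb.
Proof. by move=> v w; apply/asboolP/asboolP; exact: hnn_eq_sym. Qed.

Lemma hnn_eqb_trans : transitive hnn_eqb.
Proof.
move=> v u w /asboolP uv /asboolP vw; apply/asboolP.
exact: hnn_eq_trans uv vw.
Qed.

Canonical hnn_equiv := EquivRel hnn_eqb hnn_eqb_refl hnn_eqb_sym hnn_eqb_trans.

Definition hnn := {eq_quot hnn_eqb}.
HB.instance Definition _ := Choice.on hnn.
HB.instance Definition _ := EqQuotient.on hnn.

Lemma hnn_eqP v w : (\pi_hnn v = \pi_hnn w) <-> hnn_eq A phi v w.
Proof. by split=> [/eqmodP/asboolP //|vw]; apply/eqmodP/asboolP. Qed.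

Definition hnn_letter_inv (l : H + bool) : H + bool :=
  match l with inl h => inl h^-1 | inr b => inr (~~ b) end.

Definition hnn_word_inv (w : hnn_word H) : hnn_word H :=
  rev (map hnn_letter_inv w).

Lemma hnn_word_inv_cat v w :
  hnn_word_inv (v ++ w) = hnn_word_inv w ++ hnn_word_inv v.
Proof. by rewrite /hnn_word_inv map_cat rev_cat. Qed.

Lemma hnn_word_invK : involutive hnn_word_inv.
Proof.
move=> w; rewrite /hnn_word_inv map_rev revK -map_comp map_id_in // => -[h|b] _.
  by rewrite /= invgK.
by rewrite /= negbK.
Qed.

Lemma hnn_eq_mulwV w : hnn_eq A phi (w ++ hnn_word_inv w) [::].
Proof.
elim: w => [|l w IHw]; first exact: hnn_eq_refl.
rewrite -[l :: w]cat1s hnn_word_inv_cat -catA (catA w).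
have step : hnn_eq A phi ([:: l] ++ (w ++ hnn_word_inv w) ++ hnn_word_inv [:: l])
                         ([:: l] ++ [::] ++ hnn_word_inv [:: l]).
  apply: hnn_eq_cat (hnn_eq_refl _ _ _) _.
  by apply: hnn_eq_cat IHw _; exact: hnn_eq_refl.
apply: hnn_eq_trans step _; case: l => [h|b] /=; last exact: hnn_eq_cancel.
apply: hnn_eq_trans (hnn_eq_mul _ _ _ _) _.
by rewrite mulgV; exact: hnn_eq_one.
Qed.

Lemma hnn_eq_mulVw w : hnn_eq A phi (hnn_word_inv w ++ w) [::].
Proof. by rewrite -{2}[w]hnn_word_invK; exact: hnn_eq_mulwV. Qed.

Lemma hnn_eq_inv v w :
  hnn_eq A phi v w -> hnn_eq A phi (hnn_word_inv v) (hnn_word_inv w).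
Proof.
move=> vw; set v' := hnn_word_inv v; set w' := hnn_word_inv w.
have e1 : hnn_eq A phi v' (v' ++ (w ++ w')).
  rewrite -{1}[v']cats0; apply: hnn_eq_cat (hnn_eq_refl _ _ _) _.
  exact/hnn_eq_sym/hnn_eq_mulwV.
apply: hnn_eq_trans e1 _; rewrite catA -{2}[w']cat0s.
apply: hnn_eq_cat (hnn_eq_refl _ _ _); apply: hnn_eq_trans (hnn_eq_mulVw v).
by apply: hnn_eq_cat (hnn_eq_refl _ _ _) _; exact: hnn_eq_sym.
Qed.

Definition hnn_one : hnn := \pi_hnn [::].
Definition hnn_mul (x y : hnn) : hnn := \pi_hnn (repr x ++ repr y).
Definition hnn_inv (x : hnn) : hnn := \pi_hnn (hnn_word_inv (repr x)).

Lemma hnn_eq_repr w : hnn_eq A phi (repr (\pi_hnn w)) w.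
Proof. by apply/hnn_eqP; rewrite reprK. Qed.

Lemma pi_hnn_mul v w : \pi_hnn (v ++ w) = hnn_mul (\pi_hnn v) (\pi_hnn w).
Proof.
by apply/hnn_eqP; apply: hnn_eq_cat; apply/hnn_eq_sym/hnn_eq_repr.
Qed.

Lemma pi_hnn_inv w : \pi_hnn (hnn_word_inv w) = hnn_inv (\pi_hnn w).
Proof. by apply/hnn_eqP/hnn_eq_inv/hnn_eq_sym/hnn_eq_repr. Qed.

Lemma hnn_ind (P : hnn -> Prop) : (forall w, P (\pi_hnn w)) -> forall x, P x.
Proof. by move=> Ppi x; rewrite -[x]reprK. Qed.

Lemma hnn_mulA : associative hnn_mul.
Proof.
elim/hnn_ind=> u; elim/hnn_ind=> v; elim/hnn_ind=> w.
by rewrite -(pi_hnn_mul v w) -(pi_hnn_mul u v) -(pi_hnn_mul u) -(pi_hnn_mul _ w)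
  catA.
Qed.

Lemma hnn_mul1 : left_id hnn_one hnn_mul.
Proof. by elim/hnn_ind=> w; rewrite -(pi_hnn_mul [::] w). Qed.

Lemma hnn_mulr1 : right_id hnn_one hnn_mul.
Proof. by elim/hnn_ind=> w; rewrite -(pi_hnn_mul w [::]) cats0. Qed.

Lemma hnn_mulV : left_inverse hnn_one hnn_inv hnn_mul.
Proof.
elim/hnn_ind=> w; rewrite -(pi_hnn_inv w) -(pi_hnn_mul _ w).
exact/hnn_eqP/hnn_eq_mulVw.
Qed.

Lemma hnn_mulrV : right_inverse hnn_one hnn_inv hnn_mul.
Proof.
elim/hnn_ind=> w; rewrite -(pi_hnn_inv w) -(pi_hnn_mul w).
exact/hnn_eqP/hnn_eq_mulwV.
Qed.

HB.instance Definition _ := isGroup.Build hnn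
  hnn_mulA hnn_mul1 hnn_mulr1 hnn_mulV hnn_mulrV.

Definition hnn_base (h : H) : hnn := \pi_hnn [:: inl h].
Definition hnn_stable : hnn := \pi_hnn [:: inr false].

Lemma hnn_baseM : {morph hnn_base : h k / h * k}.
Proof.
move=> h k; rewrite /hnn_base -[RHS]pi_hnn_mul.
by apply/hnn_eqP/hnn_eq_sym/hnn_eq_mul.
Qed.

Lemma hnn_base_conj u : u \in A ->
  hnn_base u ^ hnn_stable = hnn_base (phi u).
Proof.
move=> uA; rewrite /conjg; have -> : hnn_stable^-1 = \pi_hnn [:: inr true].
  by rewrite -[LHS]pi_hnn_inv.
rewrite -[X in _ * X]pi_hnn_mul -[LHS]pi_hnn_mul /=.
exact/hnn_eqP/hnn_eq_conj.
Qed.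

(* The universal property of the presentation. *)
Lemma hnn_universal (K : groupType) (f : H -> K) (s : K) :
  {morph f : h k / h * k} -> {in A, forall u, f u ^ s = f (phi u)} ->
  exists! F : hnn -> K,
    [/\ {morph F : x y / x * y}, F \o hnn_base = f & F hnn_stable = s].
Proof.
move=> fM fs.
have f1 : f 1 = 1 by apply: (@mulgI _ (f 1)); rewrite -fM !mulg1.
pose ev (l : H + bool) :=
  match l with inl h => f h | inr b => if b then s^-1 else s end.
pose evw w := \prod_(l <- w) ev l.
have evwM v w : evw (v ++ w) = evw v * evw w by rewrite /evw big_cat.
have evE v w : hnn_eq A phi v w -> evw v = evw w.
  elim=> //= {v w}.
  - by move=> u v w _ -> _ ->.
  - by move=> v v' w w' _ vv' _ ww'; rewrite !evwM vv' ww'.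
  - by rewrite /evw big_seq1 big_nil.
  - by move=> h k; rewrite /evw big_cons !big_seq1 /= fM.
  - by move=> [] /=; rewrite /evw big_cons big_seq1 big_nil /= ?mulVg ?mulgV.
  - by move=> u /fs; rewrite /evw !big_cons !big_nil /= !mulg1.
have evpi w : evw (repr (\pi_hnn w)) = evw w by apply/evE/hnn_eq_repr.
exists (fun x => evw (repr x)); split.
  split.
  - by move=> x y; rewrite evpi evwM.
  - by apply/funext => h /=; rewrite evpi /evw big_seq1.
  - by rewrite evpi /evw big_seq1.
move=> F [FM Fb Fs]; apply/funext => x; rewrite -[x]reprK evpi.
have F1 : F 1 = 1 by apply: (@mulgI _ (F 1)); rewrite -FM !mulg1.
elim: (repr x) => [|l w IHw]; first by rewrite /evw big_nil.
rewrite -cat1s evwM IHw pi_hnn_mul FM; congr (_ * _).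
rewrite /evw big_seq1; case: l => [h|[]] //=.
- by rewrite -Fb.
- have -> : \pi_hnn [:: inr true] = hnn_stable^-1 by rewrite -[RHS]pi_hnn_inv.
  by apply: (@mulgI _ (F hnn_stable)); rewrite -FM mulgV F1 Fs mulgV.
Qed.

End HNN.

Section Growth.
Variable G : groupType.

Definition set_mulg (S T : set G) : set G := [set s * t | s in S & t in T].

Definition word_over (X : {fset G}) (w : seq G) : Prop :=
  {in w, forall x, x \in X \/ x^-1 \in X}.

Definition generates (X : {fset G}) : Prop :=
  forall g : G, exists2 w, word_over X w & g = \prod_(x <- w) x.

Definition word_ball (X : {fset G}) (n : nat) : set G :=
  [set g | exists w, [/\ word_over X w, (size w <= n)%N & g = \prod_(x <- w) x]].

Definition conj_class (g : G) : set G := [set g ^ x | x in [set: G]].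

Definition conj_growth (X : {fset G}) (n : nat) : nat :=
  #|` fset_set [set conj_class g | g in word_ball X n]|.

(* [fset_set] is only meaningful on finite sets. *)
Lemma finite_word_ball (X : {fset G}) n : finite_set (word_ball X n).
Proof.
elim: n => [|n IHn].
  apply: (@sub_finite_set _ _ [set 1]); last exact: finite_set1.
  by move=> g [[|x w] [_ // _ ->]]; rewrite big_nil.
pose Y := [set` X] `|` [set x^-1 | x in [set` X]].
have finY : finite_set Y.
  by rewrite finite_setU; split; [|apply: finite_image]; exact: finite_fset.
apply: (@sub_finite_set _ _
    ([set 1] `|` [set y * g | y in Y & g in word_ball X n])); last first.
  rewrite finite_setU; split; first exact: finite_set1.
  exact: finite_image2.
move=> g [[|x w] [Xw sw ->]]; first by left; rewrite big_nil.
right; exists x.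
  have [Xx|Xx] := Xw x (mem_head x w); first by left.
  by right; exists x^-1 => //; rewrite invgK.
exists (\prod_(y <- w) y); last by rewrite big_cons.
by exists w; split=> // y yw; apply: Xw; rewrite inE yw orbT.
Qed.

Lemma finite_conj_classes_word_ball (X : {fset G}) n :
  finite_set [set conj_class g | g in word_ball X n].
Proof. exact/finite_image/finite_word_ball. Qed.

End Growth.

Definition exponential (R : realType) (f : nat -> nat) : Prop :=
  exists2 lambda : R, (1 < lambda)%R &
    exists N, forall n, (N <= n)%N -> (lambda ^+ n <= (f n)%:R)%R.

(* Main.v *)
Require Import Defs.
From HB Require Import structures.
From mathcomp Require Import all_boot all_order all_algebra.
From mathcomp Require Import finmap generic_quotient.
From mathcomp Require Import all_classical reals.
From mathcomp Require Import zify lra.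

Import Order.TTheory GRing.Theory Num.Theory.

(** Write [t] for the stable letter.  The hypothesis [AB \cup BA <> H] is used
    only through its consequence that some [h] in [H] lies outside [A \cup B].
    For a sequence of signs [s = e_1, ..., e_m], put
    [x_s = t^(e_1) h ... t^(e_m) h].  Since [h] lies in neither associated
    subgroup, this expression is reduced, and it stays reduced when it is read
    cyclically.

    If [x_s] and [x_s'] are conjugate, and [s] and [s'] have the same length,
    then [s'] is a rotation of [s] ([conj_sign_elt_rot]).  This is the part of
    Collins' conjugacy criterion for HNN extensions that concerns the signs, and
    it comes from Britton's lemma.  The group acts on normal forms
    ([act_word_eq]).  A word with [n] letters changes the sign sequence of a
    normal form only by replacing a prefix of length at most [n] by another one
    ([signs_act_word]), whereas [x_s], applied to a normal form of length [n],
    cancels with it at most [n] times and then pushes all its remaining signs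
    ([signs_sign_word]).  If [x_s'] is the conjugate of [x_s] by a word with [n]
    letters, then so are their [k]-th powers.  For [k] large compared with [n],
    the periodic sequences [s^k] and [s'^k] therefore agree on a window of
    length [m] up to a shift, so that [s'] is a rotation of [s] when both have
    length [m].

    At most [m] sign sequences of length [m] are rotations of a given one.  If
    [C] bounds the word lengths of [t h] and [t^-1 h], the ball of radius [C m]
    thus meets at least [2^m / m] conjugacy classes ([conj_growth_ge]), and
    this bound is exponential. *)

Local Open Scope classical_set_scope.
Local Open Scope quotient_scope.
Local Open Scope group_scope.

Set Implicit Arguments.
Unset Strict Implicit.
Unset Printing Implicit Defensive.

(** * Powers and rotations of sequences *)

Section Rotations.
Variable T : Type.
Implicit Types s : seq T.

(** The concatenation of [k] copies of [s]. *)
Definition seq_pow s k := flatten (nseq k s).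

Lemma size_seq_pow s k : size (seq_pow s k) = (k * size s)%N.
Proof. by rewrite /seq_pow size_flatten /shape map_nseq sumn_nseq mulnC. Qed.

Lemma nth_seq_pow x0 s k i :
  (i < k * size s)%N -> nth x0 (seq_pow s k) i = nth x0 s (i %% size s).
Proof.
elim: k i => [|k IH] i; first by rewrite mul0n.
rewrite -[seq_pow _ _]/(s ++ seq_pow s k) nth_cat; case: (ltnP i (size s)) => [lis _|lis].
  by rewrite modn_small.
rewrite mulSn -ltn_subLR // => /IH ->.
by rewrite -[in RHS](subnKC lis) modnDl.
Qed.

Lemma nth_rot x0 s i j : (i <= size s)%N -> (j < size s)%N ->
  nth x0 (rot i s) j = nth x0 s ((i + j) %% size s).
Proof.
move=> li lj; rewrite /rot nth_cat size_drop nth_drop.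
case: ltnP => lij; first by rewrite modn_small // -ltn_subRL.
rewrite nth_take; last lia.
have -> : (i + j = (j - (size s - i)) + size s)%N by lia.
by rewrite modnDr modn_small //; lia.
Qed.

(** Sequences of equal length whose periodic extensions differ by a shift are
    rotations of each other. *)
Lemma rot_of_shift x0 s s' p j : size s = size s' -> (0 < size s)%N ->
    (forall i, (i < size s)%N ->
      nth x0 s' ((p + i) %% size s) = nth x0 s ((j + i) %% size s)) ->
  exists2 i, (i < size s)%N & s' = rot i s.
Proof.
move=> ss s0 E; pose m := size s.
have E' : rot (p %% m) s' = rot (j %% m) s.
  apply: (@eq_from_nth _ x0); first by rewrite !size_rot.
  move=> i; rewrite size_rot -ss => im.
  by rewrite !nth_rot -?ss // ?modnDml ?E // ltnW // ltn_pmod.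
have := congr1 (rotr (p %% m)) E'; rewrite rotK => ->.
rewrite /rotr rot_add_mod ?size_rot ?leq_subr //; last by rewrite ltnW // ltn_pmod.
case: ifP => l; last first.
  eexists; last by [].
  have := leq_subr (p %% m) (size s); have := @ltn_pmod j m s0; rewrite -/m; lia.
(* A rotation by the full length is the identity, hence the index [0]. *)
case: (ltngtP (size s - p %% m + j %% m) (size s)) l => // [l _|-> _].
  by eexists; last by [].
by exists 0%N; rewrite // rot_size rot0.
Qed.

End Rotations.

(** * Words acting on normal forms *)

Section NormalForms.
Variables (H : groupType) (A B : groupClosed H) (phi psi : H -> H).
Hypothesis phiM : {in A &, {morph phi : u v / u * v}}.
Hypothesis phiAB : {in A, forall u, phi u \in B}.
Hypothesis psiBA : {in B, forall v, psi v \in A}.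
Hypothesis phiK : {in A, cancel phi psi}.
Hypothesis psiK : {in B, cancel psi phi}.

(** The associated subgroup that moves from the right to the left of the letter
    [inr e]: as [inr true] is [t^-1] and [t^-1 u = phi u t^-1] for [u] in [A],
    it is [A] for [e = true] and [B] for [e = false]. *)
Definition assoc (e : bool) : groupClosed H := if e then A else B.

(** What an element of [assoc e] becomes when it moves to the left of [inr e]. *)
Definition assoc_iso (e : bool) : H -> H := if e then phi else psi.

Lemma assoc_iso_in e : {in assoc e, forall u, assoc_iso e u \in assoc (~~ e)}.
Proof. by case: e. Qed.

Lemma assoc_isoNK e : {in assoc (~~ e), cancel (assoc_iso (~~ e)) (assoc_iso e)}.
Proof. by case: e. Qed.

Lemma assoc_isoM e : {in assoc e &, {morph assoc_iso e : u v / u * v}}.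
Proof.
case: e => //= u v uB vB.
by rewrite -{1}(psiK uB) -{1}(psiK vB) -phiM ?phiK ?gpredM ?psiBA.
Qed.

(** A representative of the right coset of [x] modulo [assoc e].  It depends on
    the coset only; the trivial coset need not be represented by [1]. *)
Definition coset_rep (e : bool) (x : H) : H :=
  choose (fun y => x / y \in assoc e) x.

Lemma coset_repP e x : x / coset_rep e x \in assoc e.
Proof. by apply: (@chooseP _ (fun y => x / y \in assoc e)) => /=; rewrite mulgV gpred1. Qed.

Lemma coset_repM e u x : u \in assoc e -> coset_rep e (u * x) = coset_rep e x.
Proof.
move=> ue; rewrite /coset_rep.
have E : (fun y => u * x / y \in assoc e) =1 (fun y => x / y \in assoc e).
  by move=> y; rewrite -mulgA (gpredMl _ ue).
rewrite (eq_choose E); apply: choose_id; last by rewrite mulgV gpred1.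
by rewrite -E mulgV gpred1.
Qed.

Lemma coset_rep_id e x : coset_rep e (coset_rep e x) = coset_rep e x.
Proof. by rewrite -[in RHS](mulgVK (coset_rep e x) x) coset_repM ?coset_repP. Qed.

Lemma coset_rep_in e x : (coset_rep e x \in assoc e) = (x \in assoc e).
Proof. by rewrite -[in RHS](mulgVK (coset_rep e x) x) (gpredMl _ (coset_repP e x)). Qed.

(** The pair [(x, [:: (e_1, y_1); ...; (e_n, y_n)])] stands for the element
    [x t^(e_1) y_1 ... t^(e_n) y_n], where [t^e] is the letter [inr e]. *)
Definition nform := (H * seq (bool * H))%type.

(** The sign sequence of a normal form. *)
Definition signs (s : nform) : seq bool := unzip1 s.2.

(** The letter [inr e] cancels with the first stable letter of [r] in
    [t^e x r]. *)
Definition cancels (e : bool) (x : H) (r : seq (bool * H)) : bool :=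
  if r is (e', _) :: _ then (e' == ~~ e) && (x \in assoc e) else false.

(** Normal forms proper: the [y_i] are the chosen coset representatives, and no
    two consecutive stable letters cancel. *)
Fixpoint nreduced (r : seq (bool * H)) : bool :=
  if r is (e, y) :: r' then
    [&& coset_rep e y == y, ~~ cancels e y r' & nreduced r']
  else true.

(** Left multiplication of a normal form by a letter.  If [t^e] does not cancel,
    the part of the head that lies in [assoc e] moves to its left and a coset
    representative stays on its right. *)
Definition act_letter (l : H + bool) (s : nform) : nform :=
  match l with
  | inl h => (h * s.1, s.2)
  | inr e =>
    if cancels e s.1 s.2 then
      (assoc_iso e s.1 * (head (e, 1) s.2).2, behead s.2)
    else (assoc_iso e (s.1 / coset_rep e s.1), (e, coset_rep e s.1) :: s.2)
  end.

Definition act_word (w : hnn_word H) (s : nform) : nform :=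
  foldr act_letter s w.

Lemma act_word_cons l w s : act_word (l :: w) s = act_letter l (act_word w s).
Proof. by []. Qed.

Lemma act_word_cat v w s : act_word (v ++ w) s = act_word v (act_word w s).
Proof. exact: foldr_cat. Qed.

Lemma cancels_rep e x r : cancels e (coset_rep e x) r = cancels e x r.
Proof. by case: r => [|[e' y] r] //=; rewrite coset_rep_in. Qed.

Lemma act_letter_reduced l s : nreduced s.2 -> nreduced (act_letter l s).2.
Proof.
case: l s => [h|e] [x r] //= rr; case: ifP => [|ncan] /=.
  by case: r rr => [|[e' y] r] //= /and3P[].
by rewrite coset_rep_id eqxx cancels_rep ncan.
Qed.

Lemma act_word_reduced w s : nreduced s.2 -> nreduced (act_word w s).2.
Proof. by move=> rs; elim: w => //= l w; exact: act_letter_reduced. Qed.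

Lemma act_letterK e s :
  nreduced s.2 -> act_letter (inr e) (act_letter (inr (~~ e)) s) = s.
Proof.
case: s => x r /= rr; case can: (cancels (~~ e) x r) => /=; last first.
  have pe : assoc_iso (~~ e) (x / coset_rep (~~ e) x) \in assoc e.
    by have := assoc_iso_in (coset_repP (~~ e) x); rewrite negbK.
  by rewrite eqxx pe /= assoc_isoNK ?coset_repP ?mulgVK.
(* The letter [inr (~~ e)] cancelled the first stable letter of the form; since
   the form is reduced, [inr e] pushes that letter back. *)
case: r rr can => [|[e' y] r] //= /and3P[/eqP yrep ncan _].
rewrite negbK => /andP[/eqP e'E xe]; rewrite {}e'E in yrep ncan *.
have pxe : assoc_iso (~~ e) x \in assoc e by have := assoc_iso_in xe; rewrite negbK.
have repE : coset_rep e (assoc_iso (~~ e) x * y) = y by rewrite coset_repM.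
rewrite -cancels_rep repE (negPf ncan) mulgK.
by rewrite assoc_isoNK.
Qed.

Lemma act_letter_iso e u s : u \in assoc e ->
  act_letter (inr e) (act_letter (inl u) s) =
  act_letter (inl (assoc_iso e u)) (act_letter (inr e) s).
Proof.
case: s => x r ue /=; rewrite -cancels_rep coset_repM // cancels_rep.
case: ifP => [|_] /=.
  by case: r => [|[e' y] r] //= /andP[_ xe]; rewrite assoc_isoM ?mulgA.
by rewrite -mulgA (assoc_isoM ue) ?coset_repP.
Qed.

(** The action on reduced normal forms factors through the HNN extension. *)
Lemma act_word_eq v w s :
  hnn_eq A phi v w -> nreduced s.2 -> act_word v s = act_word w s.
Proof.
move=> vw; elim: vw s => {v w} //.
- by move=> v w _ IH s rs; rewrite IH.
- by move=> u v w _ IHuv _ IHvw s rs; rewrite IHuv ?IHvw.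
- move=> v v' w w' _ IHv _ IHw s rs.
  by rewrite !act_word_cat IHw // IHv // act_word_reduced.
- by case=> x r _ /=; rewrite mul1g.
- by move=> h k [x r] _ /=; rewrite mulgA.
- by move=> b s rs; exact: act_letterK.
- move=> u uA s rs.
  rewrite -[LHS]/(act_letter (inr true) (act_letter (inl u) _)).
  by rewrite (@act_letter_iso true) // (@act_letterK true).
Qed.

Lemma signs_act_letter l s :
  [\/ signs (act_letter l s) = signs s,
      exists e, signs (act_letter l s) = e :: signs s |
      signs s <> [::] /\ signs (act_letter l s) = behead (signs s)].
Proof.
case: l s => [h|e] [x r]; first exact: Or31.
rewrite /signs /=; case: ifP => [can|_]; last by apply: Or32; exists e.
by apply: Or33; case: r can => [|[]].
Qed.

Lemma signs_act_word w s : exists P j,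
  [/\ (size P <= size w)%N, (j <= size w)%N &
      signs (act_word w s) = P ++ drop j (signs s)].
Proof.
elim: w => [|l w [P [j [Pw jw IH]]]]; first by exists [::], 0; rewrite drop0.
have [E|[e E]|[_ E]] := signs_act_letter l (act_word w s).
- by exists P, j; split; [exact: leqW | exact: leqW | rewrite act_word_cons E].
- exists (e :: P), j.
  by split; [exact: Pw | exact: leqW | rewrite act_word_cons E IH].
- case: P Pw IH => [|e P] Pw IH.
    exists [::], j.+1; split => //.
    by rewrite act_word_cons E IH /= -drop1 drop_drop add1n.
  exists P, j.
  by split; [exact/leqW/ltnW | exact: leqW | rewrite act_word_cons E IH].
Qed.

Section SignWords.
Variable h : H.
Hypothesis hassoc : forall e, h \notin assoc e.

(** The word [t^(e_1) h ... t^(e_m) h]. *)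
Definition sign_word (s : seq bool) : hnn_word H :=
  flatten [seq [:: inr e; inl h] | e <- s].

(** Applied to a normal form, [sign_word s] first cancels, for the part [s2] of
    [s], and then pushes all the signs of [s1]. *)
Lemma signs_sign_word s st : exists s1 s2 R,
  [/\ s = s1 ++ s2, (size s2 <= size (signs st))%N &
      signs (act_word (sign_word s) st) = s1 ++ R].
Proof.
(* Either all the letters so far have cancelled, or the last one was pushed and
   the head lies in the image of [assoc_iso e].  In the second case [h] times
   the head is not in [assoc (~~ e)], so that no later letter cancels. *)
suff [[ls Es]|[e [s1 [s2 [R [Es ls2 ER _]]]]]] :
    ((size s <= size (signs st))%N /\
      size (signs (act_word (sign_word s) st)) = (size (signs st) - size s)%N)
    \/ (exists e s1 s2 R,
    [/\ s = (e :: s1) ++ s2, (size s2 <= size (signs st))%N,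
      signs (act_word (sign_word s) st) = (e :: s1) ++ R &
      (act_word (sign_word s) st).1 \in assoc (~~ e)]).
- by exists [::], s, (signs (act_word (sign_word s) st)).
- by exists (e :: s1), s2, R.
elim: s => [|e s]; first by left; rewrite /= subn0.
rewrite [sign_word _]/= !act_word_cons.
case: (act_word (sign_word s) st) => x r [[ls Es]|].
  rewrite /=; case: ifP => [|_].
    case: r Es => // -[e' y] r /= Es _; left.
    by rewrite /signs /= in Es *; split; lia.
  right; exists e, [::], s, (signs (x, r)); split=> //=.
  by rewrite assoc_iso_in ?coset_repP.
case=> [e' [s1 [s2 [R [Es ls2 ER /= xe]]]]] /=; case: ifP => [|_].
  case: r ER => // -[e'' y] r [-> _] /= /andP[/eqP E].
  rewrite E negbK in xe; rewrite gpredMr // => hin.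
  by have := hassoc e; rewrite hin.
right; exists e, (e' :: s1), s2, R; split=> //=; first by rewrite Es.
  by rewrite /signs /= -/(signs (x, r)) ER.
by rewrite assoc_iso_in ?coset_repP.
Qed.

Lemma size_hnn_word_inv (w : hnn_word H) : size (hnn_word_inv w) = size w.
Proof. by rewrite /hnn_word_inv size_rev size_map. Qed.

(** If [sign_word s'] is conjugate to [sign_word s], then [s'] is a shift of [s]
    away from the ends, within a distance given by the conjugating word. *)
Lemma conj_sign_word_shift (s s' : seq bool) (w : hnn_word H) :
    hnn_eq A phi (hnn_word_inv w ++ sign_word s ++ w) (sign_word s') ->
  exists p j, [/\ (p <= size w)%N, (j <= size w)%N & forall i,
    (p + i < size s')%N -> (j + i + size w < size s)%N ->
    nth false s' (p + i) = nth false s (j + i)].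
Proof.
move=> /act_word_eq - /(_ (1, [::]) isT); rewrite !act_word_cat.
have [Q [q [Qw _ EQ]]] := signs_act_word w (1, [::]).
set st := act_word w _ in EQ *.
have stw : (size (signs st) <= size w)%N by rewrite EQ cats0.
have [s1 [s2 [R [Es ls2 ER]]]] := signs_sign_word s st.
have [P [j [Pw jw EP]]] :=
  signs_act_word (hnn_word_inv w) (act_word (sign_word s) st).
have [s1' [s2' [R' [Es' ls2' ER']]]] := signs_sign_word s' (1, [::]).
case: s2' Es' ls2' => // Es' _.
rewrite cats0 in Es'; rewrite size_hnn_word_inv in Pw jw.
move=> /(congr1 signs); rewrite EP ER ER' -{s1' ER'}Es' => E.
exists (size P), j; split => // i lP lj.
have := congr1 (fun l => nth false l (size P + i)) E.
rewrite nth_cat ltnNge leq_addr /= addKn nth_drop nth_cat nth_cat lP.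
rewrite Es size_cat in lj; case: ltnP => [l1 <-|]; last lia.
by rewrite Es nth_cat l1.
Qed.

(** The element [t^e h] of the HNN extension. *)
Definition sign_elt (e : bool) : hnn A phi := \pi_(hnn A phi) [:: inr e; inl h].

Lemma sign_eltE s : \prod_(e <- s) sign_elt e = \pi_(hnn A phi) (sign_word s).
Proof.
elim: s => [|e s IH]; first by rewrite big_nil.
by rewrite big_cons IH -[LHS]pi_hnn_mul.
Qed.

Lemma prod_seq_pow s k :
  \prod_(e <- seq_pow s k) sign_elt e = (\prod_(e <- s) sign_elt e) ^+ k.
Proof.
elim: k => [|k IH]; first by rewrite big_nil.
by rewrite expgS -IH -big_cat.
Qed.

Lemma conj_sign_elt_rot s s' : size s = size s' -> (0 < size s)%N ->
    conj_class (\prod_(e <- s) sign_elt e) =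
    conj_class (\prod_(e <- s') sign_elt e) ->
  exists2 i, (i < size s)%N & s' = rot i s.
Proof.
move=> ss s0 cc.
have [g _ gs] : conj_class (\prod_(e <- s) sign_elt e)
    (\prod_(e <- s') sign_elt e).
  by rewrite cc; exists 1 => //; rewrite conjg1.
(* The window lost at both ends has length at most [2 * size w], so this
   exponent leaves a full period. *)
pose w := repr g; pose k := (2 * size w).+1.
have : hnn_eq A phi (hnn_word_inv w ++ sign_word (seq_pow s k) ++ w)
                    (sign_word (seq_pow s' k)).
  apply/hnn_eqP; rewrite !pi_hnn_mul -!sign_eltE !prod_seq_pow pi_hnn_inv reprK.
  by rewrite -gs -conjXg.
move=> /conj_sign_word_shift[p [j [pw jw E]]].
apply: (@rot_of_shift _ false _ _ p j) => // i im.
have km : (2 * size w * size s >= 2 * size w)%N by rewrite leq_pmulr.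
have lp : (p + i < k * size s)%N by rewrite /k mulSn; lia.
have lj : (j + i + size w < k * size s)%N by rewrite /k mulSn; lia.
have := E i; rewrite !size_seq_pow -ss => /(_ lp lj).
by rewrite !nth_seq_pow -?ss //; lia.
Qed.

End SignWords.
End NormalForms.

(** * Counting conjugacy classes *)

Lemma leq_card_fibres (S T : finType) (f : S -> T) d :
  (forall y, (#|[pred x | f x == y]| <= d)%N) -> (#|S| <= #|T| * d)%N.
Proof.
move=> fd; rewrite -sum1_card (partition_big f predT) //= -sum_nat_const.
by apply: leq_sum => y _; rewrite sum1_card; exact: fd.
Qed.

Lemma exists_gt1_expr_le2 (R : realType) (K : nat) :
  exists2 l : R, (1 < l)%R & (l ^+ K <= 2)%R.
Proof.
(* [(1 + x)^k <= 1 + (2^k - 1) x] for [0 <= x <= 1], by induction on [k]; the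
   choice of [x] makes the right-hand side at most [2] for [k = K]. *)
pose x : R := (2^-1 ^+ K)%R.
have x0 : (0 < x)%R by rewrite exprn_gt0 // invr_gt0 ltr0n.
have x1 : (x <= 1)%R by rewrite exprn_ile1 // ?invr_ge0 ?invf_le1 ?ler1n ?ltr0n.
exists (1 + x)%R; first by rewrite ltrDl.
have bound k : ((1 + x) ^+ k <= 1 + (2 ^+ k - 1) * x)%R.
  elim: k => [|k IH]; first by rewrite !expr0 subrr mul0r addr0.
  have k1 : (1 <= 2 ^+ k :> R)%R by rewrite exprn_ege1 // ler1n.
  rewrite !exprS; set y : R := (2 ^+ k)%R in IH k1 *.
  set z : R := ((1 + x) ^+ k)%R in IH *.
  have h1 : ((1 + x) * z <= (1 + x) * (1 + (y - 1) * x))%R.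
    by rewrite ler_wpM2l // addr_ge0 // ltW.
  have h2 : ((y - 1) * x * x <= (y - 1) * x)%R.
    by rewrite ler_piMr // mulr_ge0 ?subr_ge0 // ltW.
  lra.
have := bound K.
have -> : ((2 ^+ K - 1) * x = 1 - x)%R.
  by rewrite mulrBl mul1r /x -exprMn divff ?expr1n // pnatr_eq0.
move=> /le_trans; apply; lra.
Qed.

Section Counting.
Variables (G : groupType) (X : {fset G}).

Lemma word_ball_le m n : (m <= n)%N -> word_ball X m `<=` word_ball X n.
Proof.
by move=> mn g [w [Xw wm gE]]; exists w; split => //; exact: leq_trans mn.
Qed.

Lemma word_ball_prod (I : Type) (g : I -> G) C (r : seq I) :
    (forall i, word_ball X C (g i)) ->
  word_ball X (C * size r) (\prod_(i <- r) g i).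
Proof.
move=> gC; elim: r => [|i r [w [Xw wr wE]]].
  by rewrite big_nil; exists [::]; rewrite big_nil.
have [v [Xv vC vE]] := gC i; exists (v ++ w); split.
- by move=> x; rewrite mem_cat => /orP[/Xv|/Xw].
- by rewrite size_cat /= mulnS leq_add.
- by rewrite big_cons wE vE big_cat.
Qed.

Lemma conj_growth_le m n : (m <= n)%N -> (conj_growth X m <= conj_growth X n)%N.
Proof.
move=> mn; apply/fsubset_leq_card/fsubsetP => c.
rewrite !in_fset_set; try exact: finite_conj_classes_word_ball.
by rewrite !inE => -[x xm <-]; exists x => //; exact: word_ball_le xm.
Qed.

Variable g : bool -> G.
Hypothesis g_rot : forall s s' : seq bool, size s = size s' -> (0 < size s)%N ->
    conj_class (\prod_(e <- s) g e) = conj_class (\prod_(e <- s') g e) ->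
  exists2 i, (i < size s)%N & s' = rot i s.

Lemma conj_growth_ge C m : (0 < m)%N -> (forall e, word_ball X C (g e)) ->
  (2 ^ m <= conj_growth X (C * m) * m)%N.
Proof.
move=> m0 gC; rewrite /conj_growth cardfE -card_bool -card_tuple.
set F := fset_set _.
have inF (s : m.-tuple bool) : conj_class (\prod_(e <- s) g e) \in F.
  rewrite in_fset_set; last exact: finite_conj_classes_word_ball.
  rewrite inE; exists (\prod_(e <- s) g e) => //.
  by have := word_ball_prod s gC; rewrite size_tuple.
apply: (@leq_card_fibres _ _ (fun s => [` inF s]%fset)) => c.
have [/existsP[s0 /eqP c0]|/existsPn noc] :=
  boolP [exists s, [` inF s]%fset == c]; last first.
  by rewrite eq_card0 // => s; rewrite inE (negPf (noc s)).
rewrite -[X in (_ <= X)%N]card_ord.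
apply: leq_trans (leq_imset_card (fun i : 'I_m => [tuple of rot i s0]) predT).
apply/subset_leq_card/fintype.subsetP => s; rewrite inE => sc.
have : conj_class (\prod_(e <- s0) g e) = conj_class (\prod_(e <- s) g e).
  exact: etrans (congr1 val c0) (esym sc).
move=> /g_rot; rewrite !size_tuple => /(_ erefl m0)[i im sE].
by apply/imsetP; exists (Ordinal im) => //; exact: val_inj.
Qed.

(** Under [g_rot], products of [g true] and [g false] of a given length are
    conjugate only if their sign sequences are rotations of each other; this
    alone makes the conjugacy growth exponential. *)
Lemma exponential_conj_growth (R : realType) :
  generates X -> exponential R (conj_growth X).
Proof.
move=> genX.
have [C gC] : exists C, forall e, word_ball X C (g e).
  have [v Xv vE] := genX (g true); have [w Xw wE] := genX (g false).
  exists (size v + size w)%N => -[].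
  - by exists v; split => //; exact: leq_addr.
  - by exists w; split => //; exact: leq_addl.
(* The factor [2] absorbs the loss by the number of rotations, since
   [2 m <= 2^m]; the successor makes [D] positive. *)
pose D := (C * 2).+1.
have growth m : (0 < m)%N -> (2 ^ m <= conj_growth X (D * m))%N.
  case: m => // m _; have m2 : (0 < 2 * m.+1)%N by [].
  rewrite -(@leq_pmul2r (2 * m.+1)) //.
  have mle : (2 * m.+1 <= 2 ^ m.+1)%N by rewrite expnS leq_mul2l /= ltn_expl.
  apply: leq_trans (_ : 2 ^ m.+1 * 2 ^ m.+1 <= _)%N; first by rewrite leq_mul2l mle orbT.
  rewrite -expnD addnn -mul2n; apply: leq_trans (conj_growth_ge m2 gC) _.
  by rewrite leq_mul2r conj_growth_le ?orbT //; lia.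
have [l l1 lK] := exists_gt1_expr_le2 R (D * 2).
exists l => //; exists D => n Dn; pose m := (n %/ D)%N.
have m0 : (0 < m)%N by rewrite divn_gt0.
have nm : (n <= D * 2 * m)%N.
  have := ltn_ceil n (isT : (0 < D)%N); rewrite -/m mulSn => /ltnW nD.
  rewrite mulnAC muln2 -addnn (leq_trans nD) // mulnC leq_add2r.
  by rewrite leq_pmulr.
apply: (@le_trans _ _ (2 ^+ m)%R).
  apply: le_trans (_ : l ^+ (D * 2 * m) <= _)%R; first by rewrite ler_weXn2l // ltW.
  by rewrite exprM lerXn2r // ?nnegrE ?exprn_ge0 // (le_trans ler01) // ltW.
rewrite -natrX ler_nat; apply: leq_trans (growth m m0) _.
by apply: conj_growth_le; rewrite mulnC leq_trunc_div.
Qed.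

End Counting.

(** * Exponential conjugacy growth of HNN extensions *)

Theorem theorem4p2 (R : realType) (H : groupType) (A B : groupClosed H)
    (phi : H -> H)
    (phi_bij : set_bij [set` A] [set` B] phi)
    (phiM : {in A &, {morph phi : u v / u * v}})
    (X : {fset hnn A phi})
    (genX : generates X)
    (properAB : set_mulg [set` A] [set` B] `|` set_mulg [set` B] [set` A]
                <> [set: H]) :
  exponential R (conj_growth X).
Proof.
case: phi_bij => phiAB phi_inj phi_surj.
have [h hAB] : exists h, ~ (h \in A \/ h \in B).
  (* Both subgroups contain [1], so [A \cup B] is contained in [AB]. *)
  apply/existsNP => AB; apply: properAB; apply/seteqP; split => // h _; left.
  have [hA|hB] := AB h.
    by exists h => //; exists 1; rewrite ?mulg1 //= gpred1.
  by exists 1; [rewrite /= gpred1 | exists h; rewrite ?mul1g].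
have /boolp.choice[psi psiP] :
    forall v, exists u, v \in B -> u \in A /\ phi u = v.
  move=> v; have [vB|/negP vB] := boolP (v \in B); last by exists 1.
  by have [u uA uv] := phi_surj v vB; exists u.
have psiBA : {in B, forall v, psi v \in A} by move=> v /psiP[].
have psiK : {in B, cancel psi phi} by move=> v /psiP[].
have phiB : {in A, forall u, phi u \in B} by move=> u uA; exact: phiAB.
have phiK : {in A, cancel phi psi}.
  move=> u uA; apply: phi_inj; rewrite ?inE /= ?psiK ?psiBA ?phiB //.
have hassoc e : h \notin assoc A B e.
  by apply/negP => he; apply: hAB; case: e he; [left|right].
apply: exponential_conj_growth genX => s s'.
exact: (conj_sign_elt_rot phiM phiB psiBA phiK psiK hassoc).
Qed.
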